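(* Let $n \geq 1$ and $r \geq 0$ be integers. Then, in $\mathbb{Q}[S_n]$, $$M_n^r = \sum_{\lambda:\ |\lambda| \leq n} \left[ \frac{r!}{(|\lambda|+1)!} \left( \prod_i \lambda_i \right) [t^{\,r-(|\lambda|+\ell(\lambda))}]\, f(t)^{|\lambda|} \prod_i f(\lambda_i t) \right] a_{\lambda;n},$$ where the sum runs over all integer partitions $\lambda$ (including the empty one) with $|\lambda| \leq n$.
   Context: For a partition $\lambda=(\lambda_1,\ldots,\lambda_\ell)$, $|\lambda|$ is its size, $\ell(\lambda)=\ell$ its number of parts, and $m_1(\lambda)$ its number of parts equal to $1$. For $\mu \vdash n$, $C_\mu \in \mathbb{Q}[S_n]$ denotes the formal sum of all permutations of cycle type $\mu$. For $|\lambda| \leq n$, set $a_{\lambda;n} = \binom{n-|\lambda|+m_1(\lambda)}{m_1(\lambda)} C_{\lambda 1^{n-|\lambda|}}$, where $\lambda 1^{n-|\lambda|}$ is the partition of $n$ obtained by adding $n-|\lambda|$ parts equal to $1$ to $\lambda$. Let $X_{n+1} = (1\ n+1) + (2\ n+1) + \cdots + (n\ n+1) \in \mathbb{Q}[S_{n+1}]$ be the $(n+1)$-th Jucys–Murphy element, and let $\mathbb{E}:\mathbb{Q}[S_{n+1}] \to \mathbb{Q}[S_n]$ be the linear map with $\mathbb{E}(\sigma) = \sigma|_{\{1,\ldots,n\}}$ if $\sigma(n+1)=n+1$ and $\mathbb{E}(\sigma)=0$ otherwise. Define $M_n^r = \mathbb{E}(X_{n+1}^r)$. Let $f(t) = 2t^{-1}\sinh(t/2)$,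 a power series in $t$, and $[t^k]$ denotes the coefficient of $t^k$ (zero if $k<0$). *)

(* Defs.v *)
From HB Require Import structures.
From mathcomp Require Import all_boot all_order all_fingroup all_algebra.
Set Implicit Arguments. Unset Strict Implicit. Unset Printing Implicit Defensive.
Import GRing.Theory.
Local Open Scope ring_scope.

(* A separate constant, because {ffun gT -> R} already carries the pointwise
   product. *)
Definition group_alg (R : comNzRingType) (gT : finGroupType) : Type :=
  {ffun gT -> R^o}.

HB.instance Definition _ (R : comNzRingType) (gT : finGroupType) :=
  GRing.Lmodule.copy (group_alg R gT) {ffun gT -> R^o}.

Section GroupAlgebra.
Variables (R : comNzRingType) (gT : finGroupType).
Implicit Types x y z : group_alg R gT.

Definition galg_coef x (g : gT) : R := (x : {ffun gT -> R^o}) g.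

Definition galg_elt (g : gT) : group_alg R gT :=
  [ffun h : gT => (h == g)%:R : R^o].

Definition galg_mul x y : group_alg R gT :=
  [ffun g : gT => \sum_(h : gT) galg_coef x h * galg_coef y (h^-1 * g)%g : R^o].

Fact galg_mulA : associative galg_mul.
Proof.
move=> x y z; apply/ffunP=> g; rewrite !ffunE.
transitivity (\sum_(h : gT) \sum_(k : gT)
    galg_coef x h * galg_coef y (h^-1 * k)%g * galg_coef z (k^-1 * g)%g).
  apply: eq_bigr => h _; rewrite /galg_coef ffunE mulr_sumr.
  rewrite (reindex_inj (mulgI h^-1%g)) /=; apply: eq_bigr => k _.
  by rewrite mulrA invMg invgK -!mulgA mulKVg.
rewrite exchange_big; apply: eq_bigr => k _ /=.
by rewrite /galg_coef ffunE mulr_suml.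
Qed.

Fact galg_mul1l : left_id (galg_elt 1%g) galg_mul.
Proof.
move=> x; apply/ffunP=> g; rewrite !ffunE (bigD1 1%g) //= big1 => [|h h1].
  by rewrite addr0 /galg_coef ffunE eqxx mul1r invg1 mul1g.
by rewrite /galg_coef ffunE (negPf h1) mul0r.
Qed.

Fact galg_mul1r : right_id (galg_elt 1%g) galg_mul.
Proof.
move=> x; apply/ffunP=> g; rewrite !ffunE (bigD1 g) //= big1 => [|h hg].
  by rewrite addr0 /galg_coef ffunE mulVg eqxx mulr1.
by rewrite /galg_coef ffunE -eq_mulVg1 (negPf hg) mulr0.
Qed.

Fact galg_mulDl : left_distributive galg_mul +%R.
Proof.
move=> x y z; apply/ffunP=> g; rewrite !ffunE -big_split /=.
by apply: eq_bigr => h _; rewrite /galg_coef ffunE mulrDl.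
Qed.

Fact galg_mulDr : right_distributive galg_mul +%R.
Proof.
move=> x y z; apply/ffunP=> g; rewrite !ffunE -big_split /=.
by apply: eq_bigr => h _; rewrite /galg_coef ffunE mulrDr.
Qed.

Fact galg_1_neq0 : galg_elt 1%g != 0.
Proof. by apply/eqP=> /ffunP/(_ 1%g)/eqP; rewrite !ffunE eqxx oner_eq0. Qed.

HB.instance Definition _ := GRing.Zmodule_isNzRing.Build (group_alg R gT)
  galg_mulA galg_mul1l galg_mul1r galg_mulDl galg_mulDr galg_1_neq0.

Fact galg_scaleAl (a : R) x y : a *: (x * y) = (a *: x) * y.
Proof.
apply/ffunP=> g; rewrite !ffunE scaler_sumr.
by apply: eq_bigr => h _; rewrite /galg_coef ffunE; exact: mulrA.
Qed.

HB.instance Definition _ :=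
  GRing.Lmodule_isLalgebra.Build R (group_alg R gT) galg_scaleAl.

Fact galg_scaleAr (a : R) x y : a *: (x * y) = x * (a *: y).
Proof.
apply/ffunP=> g; rewrite !ffunE scaler_sumr.
by apply: eq_bigr => h _; rewrite /galg_coef ffunE; exact: mulrCA.
Qed.

HB.instance Definition _ :=
  GRing.Lalgebra_isAlgebra.Build R (group_alg R gT) galg_scaleAr.

Lemma galg_eltM (g h : gT) : galg_elt (g * h)%g = galg_elt g * galg_elt h.
Proof.
apply/ffunP=> k; rewrite !ffunE (bigD1 g) //= big1 => [|l lg].
  rewrite addr0 /galg_coef !ffunE eqxx mul1r.
  by rewrite -(inj_eq (mulgI g^-1%g)) mulKg.
by rewrite /galg_coef ffunE (negPf lg) mul0r.
Qed.

Lemma galg_decomp x : x = \sum_(g : gT) galg_coef x g *: galg_elt g.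
Proof.
apply/ffunP=> h; rewrite sum_ffunE (bigD1 h) //= big1 => [|g gh].
  by rewrite addr0 !ffunE eqxx [RHS]mulr1.
by rewrite !ffunE eq_sym (negPf gh) scaler0.
Qed.

End GroupAlgebra.

(* Q[S_n], with S_n acting on 'I_n = {0, .., n-1}: the point n+1 of the usual
   1-based convention is ord_max : 'I_n.+1.  MathComp composes permutations
   from left to right. *)
Notation "'QS_ n" := (group_alg rat 'S_n)
  (at level 8, n at level 2, format "''QS_' n").

Definition is_partition (la : seq nat) : bool :=
  sorted geq la && (0%N \notin la).

(* A partition of size at most n has at most n parts, all of them at most n. *)
Definition partitions_leq (n : nat) : seq (seq nat) :=
  [seq la <- [seq map val (val b) | b : n.-bseq 'I_n.+1]
     | is_partition la && (sumn la <= n)%N].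

Lemma partitions_leq_uniq n : uniq (partitions_leq n).
Proof.
apply/filter_uniq; rewrite map_inj_uniq ?enum_uniq //.
by move=> b c /(inj_map val_inj)/val_inj.
Qed.

Lemma mem_partitions_leq n la :
  (la \in partitions_leq n) = is_partition la && (sumn la <= n)%N.
Proof.
rewrite mem_filter; case: (boolP (is_partition la && _)) => //=.
move=> /andP[/andP[_ la0] la_n].
have size_sumn s : 0%N \notin s -> (size s <= sumn s)%N.
  elim: s => //= a s IH; rewrite inE negb_or => /andP[a0 /IH sz].
  by rewrite -add1n leq_add // lt0n eq_sym.
have mem_sumn s a : a \in s -> (a <= sumn s)%N.
  elim: s => //= b s IH; rewrite inE => /predU1P[->|/IH sz]; first exact: leq_addr.
  exact: leq_trans sz (leq_addl _ _).
have szb : (size (map (@inord n) la) <= n)%N.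
  by rewrite size_map; apply: leq_trans (size_sumn _ la0) la_n.
apply/mapP; exists (Bseq szb); first by rewrite mem_enum.
rewrite /= -map_comp -[LHS]map_id; apply/eq_in_map => a a_la /=.
by rewrite inordK // ltnS (leq_trans (mem_sumn _ _ a_la)).
Qed.

(* porbits s also contains the singleton orbits of the fixed points. *)
Definition cycle_type n (s : 'S_n) : seq nat :=
  sort geq [seq #|c| | c : {set 'I_n} in porbits s].

Definition class_sum n (mu : seq nat) : 'QS_n :=
  \sum_(s : 'S_n | cycle_type s == mu) galg_elt rat s.

Definition a_elt (la : seq nat) n : 'QS_n :=
  let m1 := count_mem 1%N la in
  'C(n - sumn la + m1, m1)%:R *: class_sum n (la ++ nseq (n - sumn la) 1%N).

Definition jucys_murphy n : 'QS_n.+1 :=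
  \sum_(i < n) galg_elt rat (tperm (lift ord_max i) ord_max).

(* Only meaningful when s fixes ord_max; otherwise the value may be the
   default 1. *)
Definition perm_restr n (s : 'S_n.+1) : 'S_n :=
  insubd (1%g : 'S_n)
    [ffun i : 'I_n => odflt i (unlift ord_max (s (lift ord_max i)))].

Lemma perm_restrE n (s : 'S_n.+1) (i : 'I_n) : s ord_max = ord_max ->
  lift ord_max (perm_restr s i) = s (lift ord_max i).
Proof.
move=> s_max.
have E j : lift ord_max (odflt j (unlift ord_max (s (lift ord_max j))))
             = s (lift ord_max j).
  case: unliftP => [k -> //|]; rewrite -[in RHS]s_max => /perm_inj/eqP.
  by rewrite eq_sym (negPf (neq_lift _ _)).
rewrite /perm_restr -pvalE insubdK ?ffunE ?E //.
apply/injectiveP=> j k; rewrite !ffunE => /(congr1 (lift ord_max)).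
by rewrite !E => /perm_inj/lift_inj.
Qed.

Definition cond_exp n (x : 'QS_n.+1) : 'QS_n :=
  \sum_(s : 'S_n.+1 | s ord_max == ord_max)
    galg_coef x s *: galg_elt rat (perm_restr s).

Definition jm_moment n r : 'QS_n := cond_exp (jucys_murphy n ^+ r).

Definition pseries := nat -> rat.

Definition ps_one : pseries := fun k => (k == 0%N)%:R.

Definition ps_mul (u v : pseries) : pseries :=
  fun k => \sum_(i < k.+1) u i * v (k - i)%N.

Definition ps_exp (u : pseries) (m : nat) : pseries := iter m (ps_mul u) ps_one.

(* u(t) |-> u(c t) *)
Definition ps_dilate (c : rat) (u : pseries) : pseries := fun k => c ^+ k * u k.

(* [t^k] u for an integer k *)
Definition ps_coef (k : int) (u : pseries) : rat :=
  if k is Posz m then u m else 0.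

(* sinh t = (e^t - e^(-t)) / 2 *)
Definition ps_sinh : pseries := fun k => (1 - (-1) ^+ k) / (2 * k`!%:R).

(* f(t) = 2 t^(-1) sinh (t / 2); the shift k.+1 is the division by t, exact
   since sinh has no constant term. *)
Definition ps_f : pseries := fun k => 2 * ps_dilate (1 / 2) ps_sinh k.+1.

(* Main.v *)
Require Import Defs.
From HB Require Import structures.
From mathcomp Require Import all_boot all_order all_fingroup all_algebra.
From mathcomp Require Import ring zify.
Set Implicit Arguments.
Unset Strict Implicit.
Unset Printing Implicit Defensive.
Import GRing.Theory Num.Theory.
Local Open Scope ring_scope.

(** The coefficient of [s] in a power [X^r] of the sum [X] of the
    transpositions [(i z)] counts the words of [r] such transpositions with
    product [s].  Sort these words by the set [A] made of [z] and of the letters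
    that occur.  For permutations of [N] points, the exponential generating
    function in [r] of the counts for a fixed [A] is, by induction on [r],
      [x^(-d) P(x)]  at  [x = e^t],  with
      [P(x) = (x - 1)^(2 d - N) chi(x) / (d + 1)!]  and  [d = #|A| - 1],
    where [chi] is the characteristic polynomial of [s].  Removing the first
    letter of a word turns this claim into an identity between [x P' - d P],
    the [P] of the [(i z) s], and the [P] of [(s z, z) s] for the set [A]
    without [s z].  Now [x - s] and [x - (i z) s] differ by a rank one matrix,
    so the adjugate [G] of [x - s] expresses the characteristic polynomial of
    [(i z) s]; the identity follows from [chi' = tr G] and from the row and
    column sums of [G].  If [z] lies on a cycle of length [p], then
    [(x^p - 1) G z z = x^(p-1) chi]; hence [chi] and the product of the
    [x^p - 1] over all cycles have the same logarithmic derivative and are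
    equal.  Finally [x^(-p/2) (x^p - 1) = 2 sinh (p t / 2) = p t f(p t)]. *)

(** * Determinants and derivatives *)

Lemma det_rank1D_lreg (R : comNzRingType) n (M : 'M[R]_n) (u : 'cV_n)
    (v : 'rV_n) : GRing.lreg (\det M) ->
  \det (M + u *m v) = \det M + (v *m \adj M *m u) 0 0.
Proof.
have det_block : \det (block_mx 1%:M (- v) u M) = \det (M + u *m v).
  have -> : block_mx 1%:M (- v) u M
      = block_mx (1%:M : 'M_1) 0 u 1%:M *m block_mx 1%:M (- v) 0 (M + u *m v).
    rewrite mulmx_block ?mul1mx ?mul0mx ?mulmx1 ?mulmx0 ?addr0 mulmxN.
    by rewrite addrCA addNr addr0.
  by rewrite det_mulmx det_lblock det_ublock !det1 !mul1r.
have : block_mx 1%:M (- v) u M *m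
         block_mx ((\det M)%:M : 'M_1) 0 (- (\adj M *m u)) 1%:M
       = block_mx ((\det M)%:M + v *m \adj M *m u) (- v) 0 M.
  rewrite mulmx_block ?mul1mx ?mulmx0 ?mulmx1 ?add0r mulmxN mulNmx opprK mulmxN.
  by rewrite !mulmxA mul_mx_adj mul_scalar_mx mul_mx_scalar subrr.
move=> /(congr1 determinant); rewrite det_mulmx det_block det_lblock det_ublock.
rewrite det1 mulr1 det_scalar1 det_mx11 mulrC !mxE eqxx mulr1n [RHS]mulrC.
by move=> eq_det reg_det; apply: reg_det; rewrite eq_det.
Qed.

Lemma det_rank1D (R : comNzRingType) n (M : 'M[R]_n) (u : 'cV_n) (v : 'rV_n) :
  \det (M + u *m v) = \det M + (v *m \adj M *m u) 0 0.
Proof.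
(* [M] is the value at [0] of a polynomial matrix with monic determinant. *)
have ev0C m p (N : 'M[R]_(m, p)) : map_mx (horner_eval 0) (map_mx polyC N) = N.
  by apply/matrixP => i j; rewrite !mxE /horner_eval hornerC.
have ev0 : map_mx (horner_eval 0) (char_poly_mx (- M)) = M.
  apply/matrixP => i j; rewrite !mxE /horner_eval.
  by rewrite hornerD hornerN hornerC opprK hornerMn hornerX mul0rn add0r.
have reg := monic_lreg (char_poly_monic (- M)).
have := det_rank1D_lreg (map_mx polyC u) (map_mx polyC v) reg.
move=> /(congr1 (horner_eval 0)); rewrite rmorphD /= -!det_map_mx map_mxD /=.
rewrite map_mxM /= !ev0C ev0 => ->; congr (_ + _).
transitivity (map_mx (horner_eval 0) (map_mx polyC v
               *m \adj (char_poly_mx (- M)) *m map_mx polyC u) 0 0).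
  by rewrite [RHS]mxE.
by rewrite !map_mxM /= !ev0C map_mx_adj ev0.
Qed.

Lemma deriv_prod (R : comNzRingType) (I : finType) (P : pred I)
    (F : I -> {poly R}) :
  (\prod_(i | P i) F i)^`()
    = \sum_(i | P i) (F i)^`() * \prod_(j | P j && (j != i)) F j.
Proof.
suff deriv_prod_seq (r : seq I) : uniq r -> (\prod_(i <- r) F i)^`()
    = \sum_(i <- r) (F i)^`() * \prod_(j <- r | j != i) F j.
  have := deriv_prod_seq _ (enum_uniq P).
  rewrite !big_enum => ->; apply: eq_bigr => i _.
  by rewrite big_enum_cond.
elim: r => [|a r IHr] /=; first by rewrite !big_nil derivC.
case/andP=> a_r uniq_r; rewrite !big_cons derivM IHr // eqxx /=.
congr (_ * _ + _).
  rewrite big_seq [RHS]big_seq_cond; apply: eq_bigl => j.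
  by case: eqVneq => [->|]; rewrite ?andbT // (negPf a_r).
rewrite mulr_sumr; apply: eq_big_seq => i i_r.
rewrite big_cons ifT; first by rewrite mulrCA.
by apply: contraNneq a_r => ->.
Qed.

Lemma polyX1_neq0 (R : nzRingType) : 'X - 1 != 0 :> {poly R}.
Proof. by rewrite -polyC1 polyXsubC_eq0. Qed.

Lemma deriv_polyX1_expM (R : comNzRingType) m (p : {poly R}) :
  ('X - 1) * (('X - 1) ^+ m * p)^`()
    = ('X - 1) ^+ m * (m%:R * p + ('X - 1) * p^`()).
Proof.
rewrite derivM deriv_exp derivB derivX -polyC1 derivC polyC1 subr0 mul1r.
case: m => [|m]; first by rewrite !mulr0n !mul0r !add0r expr0 !mul1r.
by rewrite -mulr_natl !exprS /=; ring.
Qed.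

Lemma deriv_det (R : comNzRingType) n (M : 'M[{poly R}]_n) :
  (\det M)^`() = \sum_i \sum_j (M i j)^`() * \adj M j i.
Proof.
pose leibniz_diff i (t : 'S_n) :=
  (-1) ^+ t * ((M i (t i))^`() * \prod_(j | j != i) M j (t j)).
have det_diff_row i :
    \sum_j (M i j)^`() * \adj M j i = \sum_t leibniz_diff i t.
  pose N := \matrix_(k, j) if k == i then (M k j)^`() else M k j.
  transitivity (\det N).
    rewrite (expand_det_row _ i); apply: eq_bigr => j _.
    rewrite !mxE eqxx; congr (_ * _).
    rewrite /cofactor; congr (_ * \det _); apply/matrixP => k l.
    by rewrite !mxE eq_sym (negPf (neq_lift _ _)).
  apply: eq_bigr => t _; congr (_ * _).
  rewrite (bigD1 i) //= mxE eqxx; congr (_ * _).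
  by apply: eq_bigr => j /negPf ji; rewrite mxE ji.
under eq_bigr do rewrite det_diff_row.
rewrite exchange_big raddf_sum; apply: eq_bigr => t _ /=.
rewrite -mulr_sumr -deriv_prod.
by case: (odd_perm t); rewrite ?expr1 ?expr0 ?mul1r // !mulN1r derivN.
Qed.

Lemma deriv_char_poly (R : comNzRingType) n (A : 'M[R]_n) :
  (char_poly A)^`() = \tr (\adj (char_poly_mx A)).
Proof.
rewrite deriv_det; apply: eq_bigr => i _; rewrite (bigD1 i) //= big1 => [|j ji].
  by rewrite addr0 !mxE eqxx derivB derivX derivC subr0 mul1r.
by rewrite !mxE eq_sym (negPf ji) mulr0n sub0r derivN derivC oppr0 mul0r.
Qed.

Lemma lead_coef_deriv (R : numDomainType) (p : {poly R}) :
  lead_coef p^`() = lead_coef p *+ (size p).-1.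
Proof.
have [size_p|size_p] := leqP (size p) 1.
  by rewrite [p]size1_polyC // derivC size_polyC lead_coef0; case: (_ != _).
have deg_p : (size p).-2.+1 = (size p).-1 by case: (size p) size_p => [|[]].
rewrite /deriv lead_coef_poly ?deg_p //.
  by case: (size p) size_p => [|[]].
rewrite mulrn_eq0 lead_coef_eq0 -size_poly_eq0.
by case: (size p) size_p => [|[]].
Qed.

Lemma monic_eq_log_deriv (R : numDomainType) (p q : {poly R}) :
  p \is monic -> q \is monic -> p^`() * q = p * q^`() -> p = q.
Proof.
move=> p_monic q_monic log_pq.
have size_pq : size p = size q.
  move/(congr1 lead_coef): log_pq; rewrite !lead_coefM !lead_coef_deriv.
  rewrite (monicP p_monic) (monicP q_monic) mulr1 mul1r => /eqP.
  rewrite eqr_nat.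
  have := monic_neq0 p_monic; have := monic_neq0 q_monic.
  rewrite -!size_poly_gt0; lia.
apply/eqP; rewrite -subr_eq0; apply/negPn/negP; set d := p - q => d_neq0.
have size_d : (size d < size q)%N.
  have q_gt0 : (0 < size q)%N by rewrite size_poly_gt0 monic_neq0.
  rewrite -(prednK q_gt0) ltnS; apply/leq_sizeP => j.
  rewrite leq_eqVlt coefB => /predU1P[<-|].
    by rewrite -{1}size_pq -!lead_coefE (monicP p_monic) (monicP q_monic) subrr.
  by rewrite prednK // => q_j; rewrite !nth_default ?subrr // size_pq.
have : d^`() * q = d * q^`() by rewrite derivB !mulrBl log_pq [q * _]mulrC.
move/(congr1 lead_coef); rewrite !lead_coefM !lead_coef_deriv (monicP q_monic).
rewrite mulr1 -[LHS]mulr_natr => /(mulfI _)/eqP.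
rewrite lead_coef_eq0 eqr_nat => /(_ d_neq0)/eqP.
by have := size_poly_gt0 d; rewrite d_neq0; lia.
Qed.

(** * The characteristic polynomial of a permutation *)

Lemma porbit_stable (T : finType) (s : {perm T}) x i :
  (s i \in porbit s x) = (i \in porbit s x).
Proof.
by rewrite -!eq_porbit_mem; have := porbit_perm s 1 i; rewrite expg1 => ->.
Qed.

Lemma iter_porbit_neq (T : finType) (s : {perm T}) x k :
  (0 < k < #|porbit s x|)%N -> iter k s x != x.
Proof.
case/andP=> k_gt0 k_lt; have C_gt0 := ltn_trans k_gt0 k_lt.
have := nth_uniq x _ _ (uniq_traject_porbit s x) => /(_ k 0%N).
by rewrite size_traject !nth_traject //= => ->; rewrite -?lt0n.
Qed.

Lemma porbit_fixed (T : finType) (s : {perm T}) x :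
  s x = x -> porbit s x = [set x].
Proof.
move=> s_x; apply/setP => i; rewrite inE porbit_traject; apply/trajectP/eqP.
  by case=> k _ ->; apply: iter_fix.
by move=> ->; exists 0%N; rewrite // lt0n card_porbit_neq0.
Qed.

Definition perm_char_poly (R : comNzRingType) n (s : 'S_n) : {poly R} :=
  char_poly (perm_mx s).

Section PermCharPoly.
Variables (R : comNzRingType) (n : nat) (s : 'S_n).
Implicit Types (i j z : 'I_n) (A : {set 'I_n}).

Local Notation chi := (perm_char_poly R s).
Local Notation G := (\adj (char_poly_mx (perm_mx s : 'M[R]_n))).

Lemma adj_perm_row i j : G (s i) j = 'X * G i j - chi *+ (i == j).
Proof.
have -> : chi *+ (i == j) = (char_poly_mx (perm_mx s) *m G) i j.
  by rewrite mul_mx_adj mxE.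
rewrite mulmxBl mul_scalar_mx map_perm_mx -row_permE [in RHS]mxE.
by rewrite !(mxE _ _ i j) subKr.
Qed.

Lemma adj_perm_col i j : G i j = 'X * G i (s j) - chi *+ (i == s j).
Proof.
have -> : chi *+ (i == s j) = (G *m char_poly_mx (perm_mx s)) i (s j).
  by rewrite mul_adj_mx mxE.
rewrite mulmxBr mul_mx_scalar map_perm_mx -[s in _ *m perm_mx s]invgK.
by rewrite -col_permE !mxE permK subKr.
Qed.

Lemma adj_fixed_row i j : s i = i -> ('X - 1) * G i j = chi *+ (i == j).
Proof.
by move=> s_i; rewrite mulrBl mul1r -{2}s_i adj_perm_row subKr.
Qed.

Lemma adj_fixed_col i j : s j = j -> ('X - 1) * G i j = chi *+ (i == j).
Proof.
by move=> s_j; rewrite mulrBl mul1r [X in _ - X]adj_perm_col s_j subKr.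
Qed.

Lemma sum_adj_row i : ('X - 1) * \sum_j G i j = chi.
Proof.
rewrite mulrBl mul1r mulr_sumr [X in X - _](reindex_perm s) -sumrB.
transitivity (\sum_j chi *+ (i == s j)).
  by apply: eq_bigr => j _; rewrite [X in _ - X]adj_perm_col subKr.
rewrite (bigD1 (s^-1 i)%g) //= permKV eqxx big1 ?addr0 // => j.
by rewrite -(inj_eq (@perm_inj _ s)) permKV eq_sym => /negPf->.
Qed.

Lemma sum_adj_col j : ('X - 1) * \sum_i G i j = chi.
Proof.
rewrite mulrBl mul1r mulr_sumr [X in _ - X](reindex_perm s) -sumrB.
transitivity (\sum_i chi *+ (i == j)).
  by apply: eq_bigr => i _; rewrite adj_perm_row subKr.
by rewrite (bigD1 j) //= eqxx big1 ?addr0 // => i /negPf->.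
Qed.

Lemma adj_diag_porbit z :
  ('X^#|porbit s z| - 1) * G z z = 'X^(#|porbit s z|.-1) * chi.
Proof.
have C_gt0 : (0 < #|porbit s z|)%N by rewrite lt0n card_porbit_neq0.
have adj_iter k : (k < #|porbit s z|)%N ->
    G (iter k.+1 s z) z = 'X^k * ('X * G z z - chi).
  elim: k => [|k IHk] k_lt; first by rewrite mul1r adj_perm_row eqxx.
  have /negPf iter_z : iter k.+1 s z != z by apply: iter_porbit_neq.
  by rewrite iterS adj_perm_row iter_z subr0 IHk 1?ltnW // mulrA -exprS.
have := adj_iter #|porbit s z|.-1; rewrite prednK // iter_porbit leqnn.
move=> /(_ isT) G_zz; rewrite mulrBl mul1r {2}G_zz mulrBr mulrA -exprSr.
by rewrite prednK // subKr.
Qed.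

Lemma sum_adj_diag_porbit (C : {set 'I_n}) : C \in porbits s ->
  ('X^#|C| - 1) * \sum_(i | porbit s i == C) G i i = ('X^#|C| - 1)^`() * chi.
Proof.
case/imsetP=> z _ ->; rewrite derivB derivXn -polyC1 derivC subr0 polyC1.
rewrite mulr_sumr (eq_bigr (fun=> 'X^(#|porbit s z|.-1) * chi)).
  rewrite sumr_const mulrnAl; congr (_ *+ _).
  by apply: eq_card => i; rewrite -eq_porbit_mem.
by move=> i /eqP <-; apply: adj_diag_porbit.
Qed.

Lemma perm_char_poly_tperm i z : i != z ->
  perm_char_poly R (tperm i z * s)
    = - chi + 'X * (G i i + G z z - G i z - G z i).
Proof.
move=> iz; pose u : 'cV[{poly R}]_n := delta_mx i 0 - delta_mx z 0.
pose v : 'rV[{poly R}]_n := delta_mx 0 (s i) - delta_mx 0 (s z).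
have -> : perm_char_poly R (tperm i z * s)
        = \det (char_poly_mx (perm_mx s) + u *m v).
  congr (\det _); apply/matrixP => k j.
  rewrite !mxE big_ord1 !mxE !eqxx !andbT /= !(eq_sym j) permM -!polyC_natr.
  case: (tpermP i z k) => [->|->|/eqP ki /eqP kz].
  - by rewrite eqxx (negPf iz) subr0 mul1r addrA subrK.
  - by rewrite eqxx (eq_sym z i) (negPf iz) sub0r mulN1r opprB addrA subrK.
  by rewrite (negPf ki) (negPf kz) subrr mul0r addr0.
have v_mul_u (M : 'M_n) :
    (v *m M *m u) 0 0 = M (s i) i - M (s z) i - (M (s i) z - M (s z) z).
  by rewrite mulmxBl -!rowE mulmxBr -!colE !mxE.
rewrite det_rank1D v_mul_u !adj_perm_row !eqxx (eq_sym z) (negPf iz).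
rewrite -[\det _]/chi !mulr1n !mulr0n; ring.
Qed.

Lemma perm_char_poly_del z : s z != z ->
  perm_char_poly R (tperm (s z) z * s)
    = ('X - 1) * (chi - ('X - 1) * G z z).
Proof.
move=> sz; rewrite perm_char_poly_tperm // !adj_perm_row (adj_perm_col z z).
rewrite eqxx (eq_sym z) (negPf sz) !mulr1n mulr0n; ring.
Qed.

Section SupportedSums.
Variables (A : {set 'I_n}) (z : 'I_n).
Hypotheses (sA : perm_on A s) (zA : z \in A).

Lemma sum_adj_row_support : ('X - 1) * \sum_(i in A) G z i = chi.
Proof.
rewrite -(sum_adj_row z) [in RHS](bigID (mem A)) /= [RHS]mulrDr -[LHS]addr0.
congr (_ + _); rewrite mulr_sumr big1 // => i iA.
by rewrite adj_fixed_col ?(out_perm sA) // (negPf (memPn iA z zA)).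
Qed.

Lemma sum_adj_col_support : ('X - 1) * \sum_(i in A) G i z = chi.
Proof.
rewrite -(sum_adj_col z) [in RHS](bigID (mem A)) /= [RHS]mulrDr -[LHS]addr0.
congr (_ + _); rewrite mulr_sumr big1 // => i iA.
by rewrite adj_fixed_row ?(out_perm sA) // eq_sym (negPf (memPn iA z zA)).
Qed.

Lemma sum_adj_diag_support :
  ('X - 1) * \sum_(i in A) G i i = ('X - 1) * chi^`() - #|~: A|%:R * chi.
Proof.
have fixed_diag : ('X - 1) * \sum_(i | i \notin A) G i i = #|~: A|%:R * chi.
  rewrite mulr_sumr (eq_bigr (fun=> chi)) => [|i iA]; last first.
    by rewrite adj_fixed_row ?(out_perm sA) // eqxx.
  rewrite sumr_const mulr_natl; congr (_ *+ _).
  by apply: eq_card => i; rewrite !inE.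
rewrite deriv_char_poly /mxtrace [in RHS](bigID (mem A)) /= mulrDr.
by rewrite fixed_diag addrK.
Qed.

Lemma sum_perm_char_poly_tperm :
  ('X - 1) * \sum_(i in A | i != z) perm_char_poly R (tperm i z * s)
    = ('X - 1) * ('X * chi^`() - #|A|.-1%:R * chi + #|A|%:R * 'X * G z z)
      - #|~: A|.+2%:R * 'X * chi.
Proof.
have := sum_adj_diag_support; have := sum_adj_col_support.
have := sum_adj_row_support; rewrite !(bigD1 z zA) /=.
rewrite (eq_bigr _ (fun i iA => perm_char_poly_tperm (andP iA).2)).
rewrite big_split /= -mulr_sumr !sumrB big_split /= !sumr_const.
have -> : #|[pred i in A | i != z]| = #|A|.-1.
  by rewrite (cardsD1 z A) zA /=; apply: eq_card => i; rewrite !inE andbC.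
have -> : #|A| = #|A|.-1.+1 by rewrite prednK // (cardD1 z) zA.
rewrite -(mulr_natl (- chi)) -(mulr_natl (G z z)) /=.
set m := #|A|.-1; set k := #|~: A|.
rewrite -[X in X%:R * 'X * G z z]addn1 -[k.+2]addn2 !natrD.
set row := \sum_(i | _) G z i; set col := \sum_(i | _) G i z.
set diag := \sum_(i | _) G i i => row_chi col_chi diag_chi.
have {}row_chi : ('X - 1) * row = chi - ('X - 1) * G z z.
  by rewrite -row_chi; ring.
have {}col_chi : ('X - 1) * col = chi - ('X - 1) * G z z.
  by rewrite -col_chi; ring.
have {}diag_chi : ('X - 1) * diag = ('X - 1) * (chi^`() - G z z) - k%:R * chi.
  by rewrite mulrBr addrAC -diag_chi; ring.
transitivity ('X * (('X - 1) * diag) - 'X * (('X - 1) * row)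
    - 'X * (('X - 1) * col) + ('X - 1) * (m%:R * ('X * G z z - chi))).
  by ring.
by rewrite row_chi col_chi diag_chi; ring.
Qed.

Lemma perm_char_poly_rec :
  ('X - 1) ^+ 2 * \sum_(i in A | i != z) perm_char_poly R (tperm i z * s)
    + #|A|%:R * 'X * (if s z == z then 0
                      else perm_char_poly R (tperm (s z) z * s))
  = ('X - 1) ^+ 2 * ('X * chi^`() - #|A|.-1%:R * chi)
    + ((2 * #|A|.-1)%:R - n%:R) * 'X * ('X - 1) * chi.
Proof.
have -> : (if s z == z then 0 else perm_char_poly R (tperm (s z) z * s))
        = ('X - 1) * (chi - ('X - 1) * G z z).
  case: eqVneq => [s_z|/perm_char_poly_del //].
  by rewrite adj_fixed_row // eqxx subrr mulr0.
have -> : n%:R = #|~: A|%:R + #|A|%:R :> {poly R}.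
  by rewrite -natrD addnC cardsC card_ord.
rewrite expr2 -mulrA sum_perm_char_poly_tperm.
have -> : #|A| = #|A|.-1.+1 by rewrite prednK // (cardD1 z) zA.
rewrite -pred_Sn; ring.
Qed.

End SupportedSums.
End PermCharPoly.

Lemma perm_char_poly_prod (R : numDomainType) n (s : 'S_n) :
  perm_char_poly R s = \prod_(C in porbits s) ('X^#|C| - 1).
Proof.
apply: monic_eq_log_deriv; first exact: char_poly_monic.
  apply: monic_prod => _ /imsetP[z _ ->].
  by apply: monicXnsubC; rewrite lt0n card_porbit_neq0.
rewrite deriv_char_poly deriv_prod /mxtrace (partition_big_imset (porbit s)) /=.
rewrite mulr_suml mulr_sumr; apply: eq_bigr => C C_s.
by rewrite (bigD1 C C_s) /= mulrCA mulrA sum_adj_diag_porbit // mulrAC mulrC.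
Qed.

(** * Moments of polynomials *)

Section ExpoMoment.
Variable R : comNzRingType.
Implicit Types (c : R) (p : {poly R}).

(* At [x = e^t], the derivative in [t] of [x^(-c) p(x)] is
   [x^(-c) (euler_op c p)(x)]. *)
Definition euler_op c p : {poly R} := 'X * p^`() - c *: p.

(* [k!] times the coefficient of [t^k] in [x^(-c) p(x)]. *)
Definition expo_moment c k p : R := (iter k (euler_op c) p).[1].

Lemma expo_momentS c k p :
  expo_moment c k.+1 p = expo_moment c k (euler_op c p).
Proof. by rewrite /expo_moment iterSr. Qed.

Fact expo_moment_is_linear c k : scalar (expo_moment c k).
Proof.
elim: k => [|k IHk] a p q; first by rewrite /expo_moment !hornerE.
rewrite !expo_momentS -IHk; congr (expo_moment _ _ _).
by rewrite /euler_op derivD derivZ -!mul_polyC; ring.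
Qed.

HB.instance Definition _ c k :=
  GRing.isLinear.Build R {poly R} R *%R (expo_moment c k)
    (expo_moment_is_linear c k).

Lemma expo_momentMX c k p : expo_moment (c + 1) k ('X * p) = expo_moment c k p.
Proof.
elim: k p => [|k IHk] p; first by rewrite /expo_moment /= hornerM hornerX mul1r.
rewrite !expo_momentS -IHk; congr (expo_moment _ _ _).
by rewrite /euler_op derivM derivX scalerDl scale1r -!mul_polyC; ring.
Qed.

Lemma expo_momentMXn c k m p :
  expo_moment (c + m%:R) k ('X^m * p) = expo_moment c k p.
Proof.
elim: m => [|m IHm]; first by rewrite addr0 expr0 mul1r.
by rewrite -natr1 addrA exprS -mulrA expo_momentMX.
Qed.

Lemma coef_iter_euler_op c k p i :
  (iter k (euler_op c) p)`_i = (i%:R - c) ^+ k * p`_i.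
Proof.
elim: k => [|k IHk]; first by rewrite mul1r.
rewrite iterS coefB coefZ coefXM coef_deriv exprS -mulrA -IHk mulrBl.
by case: i {IHk} => [|i]; rewrite ?mul0r // mulr_natl.
Qed.

Lemma expo_momentE c k p :
  expo_moment c k p = \sum_(i < size p) (i%:R - c) ^+ k * p`_i.
Proof.
rewrite /expo_moment (@horner_coef_wide _ (size p)) => [|].
  by apply: eq_bigr => i _; rewrite expr1n mulr1 coef_iter_euler_op.
by apply/leq_sizeP => i p_i; rewrite coef_iter_euler_op nth_default ?mulr0.
Qed.

End ExpoMoment.

(** * Permutations supported by a set *)

Section PermOn.
Variable T : finType.
Implicit Types (s : {perm T}) (A : {set T}) (i z : T).

Lemma perm_on_tperm A s i z : i \in A -> z \in A ->
  perm_on A (tperm i z * s)%g = perm_on A s.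
Proof.
move=> iA zA; have tA : perm_on A (tperm i z).
  by apply: subset_trans (tperm_on i z) _; rewrite subUset !sub1set iA.
apply/idP/idP => [tsA|]; last exact: perm_onM.
by rewrite -(mulKg (tperm i z) s) tpermV perm_onM.
Qed.

Lemma perm_onD1_tperm A s i z : i \in A -> z \in A -> i != z ->
  perm_on (A :\ i) (tperm i z * s)%g = perm_on A s && (s z == i).
Proof.
move=> iA zA iz; rewrite -(perm_on_tperm s iA zA).
have <- : (tperm i z * s)%g i = s z by rewrite permM tpermL.
set t := (tperm i z * s)%g; apply/idP/andP => [tA|[tA /eqP t_i]].
  split; first exact: subset_trans tA (subsetDl _ _).
  by apply/eqP/(out_perm tA); rewrite setD11.
apply/subsetP => j; rewrite !inE => t_j; rewrite (subsetP tA) // andbT.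
by apply: contraNneq t_j => ->; rewrite t_i.
Qed.

(* The sets supporting [tperm i z * s] that avoid [i] are the sets supporting
   [s] with [i = s z] removed. *)
Lemma sum_perm_on_tperm (V : nmodType) s i z (F : {set T} -> V) : i != z ->
  \sum_(A : {set T} | [&& z \in A, i \notin A & perm_on A (tperm i z * s)%g])
      F A
    = \sum_(A : {set T} | [&& z \in A, perm_on A s & s z == i]) F (A :\ i).
Proof.
move=> iz.
rewrite (reindex_onto (fun A : {set T} => A :\ i) (fun A => i |: A)) /=.
  apply: eq_bigl => A; rewrite !inE eqxx /= eq_sym (negPf iz) /=.
  have [iA|iA] := boolP (i \in A).
    rewrite setD1K // eqxx andbT; case zA: (z \in A) => //=.
    by rewrite perm_onD1_tperm.
  rewrite (_ : i |: A :\ i == A = false) ?andbF; last first.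
    by apply: contraNF iA => /eqP<-; rewrite setU11.
  apply/esym/negP => /and3P[zA sA /eqP s_z]; case/negP: iA.
  by rewrite -s_z (perm_closed _ sA).
by move=> A /and3P[_ iA _]; rewrite setU1K.
Qed.

Lemma ltn_card_porbits A s z : perm_on A s -> z \in A ->
  (#|~: A| < #|porbits s|)%N.
Proof.
move=> sA zA; have zAN : z \notin ~: A by rewrite inE zA.
have -> : #|~: A|.+1 = #|z |: ~: A| by rewrite cardsU1 zAN.
rewrite -(card_in_imset (f := porbit s)) => [|i j].
  by apply: subset_leq_card; apply/subsetP => _ /imsetP[i _ ->]; apply: imset_f.
have fixed k : k \in ~: A -> porbit s k = [set k].
  by rewrite inE => kA; rewrite porbit_fixed ?(out_perm sA).
rewrite !(inE, in_setU1) => /predU1P[->|]; last first.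
  move=> iA _ orb_ij; apply/esym/set1P; rewrite -fixed ?inE //.
  by rewrite orb_ij porbit_id.
case/predU1P=> [-> //|jA] orb_zj; apply/set1P; rewrite -fixed ?inE //.
by rewrite -orb_zj porbit_id.
Qed.

End PermOn.

(** * Star factorizations *)

Section StarPoly.
Variables (R : numFieldType) (n : nat).
Implicit Types (s : 'S_n) (A : {set 'I_n}) (z : 'I_n).

Local Notation chi s := (perm_char_poly R s).

(* This is [(x - 1)^(2 d - n) chi(x)] if [s] is supported by a set of [d.+1]
   points, since the quotient is then exact. *)
Definition star_poly d s : {poly R} :=
  ('X - 1) ^+ d * (chi s %/ ('X - 1) ^+ (n - d)).

Lemma dvdp_perm_char_poly A s z : perm_on A s -> z \in A ->
  ('X - 1) ^+ #|~: A|.+1 %| chi s.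
Proof.
move=> sA zA; rewrite perm_char_poly_prod.
apply: dvdp_trans (dvdp_exp2l _ (ltn_card_porbits sA zA)) _.
rewrite -prodr_const; apply: (big_rec2 (fun p q => p %| q)) => // C p q _ pq.
apply: dvdp_mul => //; rewrite -polyC1 dvdp_XsubCl rootE.
by rewrite !hornerE expr1n subrr.
Qed.

Lemma star_polyK A s z : perm_on A s -> z \in A ->
  ('X - 1) ^+ n * star_poly #|A|.-1 s = ('X - 1) ^+ (2 * #|A|.-1) * chi s.
Proof.
move=> sA zA; have chiK := divpKC (dvdp_perm_char_poly sA zA).
have A_gt0 : (0 < #|A|)%N by apply/card_gt0P; exists z.
have card_n := cardsC A; rewrite card_ord in card_n.
have d_n : (n - #|A|.-1)%N = #|~: A|.+1 by lia.
have n_d : n = (#|A|.-1 + #|~: A|.+1)%N :> nat by lia.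
rewrite /star_poly d_n -{2}chiK mul2n -addnn.
by rewrite [X in _ ^+ X * _]n_d !exprD; ring.
Qed.

Lemma star_polyK_del A s z : perm_on A s -> z \in A -> s z != z ->
  ('X - 1) ^+ n.+2 * star_poly #|A|.-2 (tperm (s z) z * s)%g
    = ('X - 1) ^+ (2 * #|A|.-1) * chi (tperm (s z) z * s)%g.
Proof.
move=> sA zA s_z; have szA : s z \in A by rewrite perm_closed.
have card_del : #|A :\ s z| = #|A|.-1 by rewrite [in RHS](cardsD1 (s z)) szA.
have zD : z \in A :\ s z by rewrite !inE eq_sym s_z.
have sD : perm_on (A :\ s z) (tperm (s z) z * s)%g.
  by rewrite perm_onD1_tperm ?sA ?eqxx.
have := star_polyK sD zD; rewrite card_del => starK.
have -> : (2 * #|A|.-1 = 2 + 2 * #|A|.-2)%N.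
  by have := cardsD1 z (A :\ s z); rewrite zD card_del; lia.
by rewrite -[n.+2]add2n [in LHS]exprD [in RHS]exprD -!mulrA starK.
Qed.

Lemma euler_op_star_polyK A s z : perm_on A s -> z \in A ->
  ('X - 1) ^+ n.+2 * euler_op #|A|.-1%:R (star_poly #|A|.-1 s)
    = ('X - 1) ^+ (2 * #|A|.-1)
      * (('X - 1) ^+ 2 * ('X * (chi s)^`() - #|A|.-1%:R * chi s)
         + ((2 * #|A|.-1)%:R - n%:R) * 'X * ('X - 1) * chi s).
Proof.
move=> sA zA; have starK := star_polyK sA zA.
set d := #|A|.-1 in starK *; set U : {poly R} := 'X - 1 in starK *.
set P := star_poly d s in starK *.
have deriv_starK : U * (U ^+ n * P)^`() = U * (U ^+ (2 * d) * chi s)^`().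
  by rewrite starK.
rewrite deriv_polyX1_expM [RHS]deriv_polyX1_expM -/U in deriv_starK.
rewrite /euler_op -mul_polyC polyC_natr.
transitivity ('X * U * (U ^+ n * (n%:R * P + U * P^`()))
    - n%:R * 'X * U * (U ^+ n * P) - d%:R * U ^+ 2 * (U ^+ n * P)).
  by rewrite -[n.+2]addn2 exprD; ring.
by rewrite deriv_starK starK; ring.
Qed.

Lemma euler_op_star_poly A s z : perm_on A s -> z \in A ->
  euler_op #|A|.-1%:R (star_poly #|A|.-1 s) =
    \sum_(i in A | i != z) star_poly #|A|.-1 (tperm i z * s)%g
    + #|A|%:R *: ('X * if s z == z then 0
                       else star_poly #|A|.-2 (tperm (s z) z * s)%g).
Proof.
move=> sA zA; set U : {poly R} := 'X - 1; set d := #|A|.-1.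
have sum_starK :
    U ^+ n * \sum_(i in A | i != z) star_poly d (tperm i z * s)%g
    = U ^+ (2 * d) * \sum_(i in A | i != z) chi (tperm i z * s)%g.
  rewrite !mulr_sumr; apply: eq_bigr => i /andP[iA _].
  by rewrite (@star_polyK A _ z) // perm_on_tperm.
have del_starK :
    U ^+ n.+2 * (if s z == z then 0 else star_poly d.-1 (tperm (s z) z * s)%g)
    = U ^+ (2 * d) * if s z == z then 0 else chi (tperm (s z) z * s)%g.
  case: eqVneq => [_|s_z]; first by rewrite !mulr0.
  exact: star_polyK_del.
have Un2_neq0 : U ^+ n.+2 != 0 by rewrite expf_neq0 ?polyX1_neq0.
apply: (mulfI Un2_neq0); rewrite (euler_op_star_polyK sA zA).
rewrite -(perm_char_poly_rec R sA zA) -/U -/d -mul_polyC polyC_natr.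
rewrite [RHS]mulrDr [_ * (#|A|%:R * _)]mulrCA [_ * ('X * _)]mulrCA del_starK.
rewrite -[n.+2]addn2 exprD.
rewrite [_ * _ * \sum_(i in A | _) star_poly _ _]mulrAC sum_starK.
(* [ring] does not identify terms that differ by ring structure instances. *)
by set x := 'X; set chi_del := if _ then _ else _; ring.
Qed.

End StarPoly.

Section StarCount.
Variables (R : numFieldType) (n : nat).
Implicit Types (s : 'S_n) (A : {set 'I_n}) (z : 'I_n).

Definition star_weight r d s : R :=
  (d.+1`!%:R)^-1 * expo_moment d%:R r (star_poly R d s).

Definition star_count r z s : R :=
  \sum_(A : {set 'I_n} | (z \in A) && perm_on A s) star_weight r #|A|.-1 s.

Lemma perm_char_poly1 : perm_char_poly R (1 : 'S_n)%g = ('X - 1) ^+ n.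
Proof.
rewrite /perm_char_poly perm_mx1 /char_poly /char_poly_mx map_scalar_mx.
by rewrite -raddfB det_scalar.
Qed.

Lemma star_count0 z s : star_count 0 z s = (s == 1%g)%:R.
Proof.
have weight0 A : z \in A -> A != [set z] -> star_weight 0 #|A|.-1 s = 0.
  move=> zA A_neq; have /negPf card_A : #|A|.-1 != 0%N.
    apply: contraNneq A_neq => card_A; rewrite eq_sym eqEcard sub1set zA cards1.
    lia.
  rewrite /star_weight /expo_moment /star_poly !hornerE subrr expr0n card_A /=.
  by rewrite mulr0 mul0r.
rewrite /star_count; have [s1|s_neq1] := eqVneq s 1%g.
  rewrite (bigD1 [set z]) /=; last by rewrite set11 s1 perm_on1.
  rewrite big1 => [|A /andP[/andP[zA _]]]; last exact: weight0.
  rewrite /star_weight /star_poly s1 perm_char_poly1 cards1 subn0 divpp.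
    by rewrite mul1r /expo_moment hornerC invr1 mul1r addr0.
  by rewrite expf_neq0 ?polyX1_neq0.
rewrite big1 // => A /andP[zA sA]; apply: weight0 => //.
apply: contraNneq s_neq1 => A_z; rewrite A_z in sA.
by apply/eqP/(perm_on_id sA); rewrite cards1.
Qed.

Lemma star_weight_rec r A s z : perm_on A s -> z \in A ->
  star_weight r.+1 #|A|.-1 s =
    \sum_(i in A | i != z) star_weight r #|A|.-1 (tperm i z * s)%g
    + if s z == z then 0 else star_weight r #|A|.-2 (tperm (s z) z * s)%g.
Proof.
move=> sA zA; rewrite /star_weight expo_momentS (euler_op_star_poly R sA zA).
rewrite linearD linear_sum linearZ mulrDr mulr_sumr /=; congr (_ + _).
case: eqVneq => [_|s_z]; first by rewrite mulr0 linear0 !mulr0.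
have [d card_A] : exists d, #|A| = d.+2.
  have := cardsD1 (s z) A; have := cardsD1 z (A :\ s z).
  rewrite !inE eq_sym s_z (perm_closed _ sA) zA => card_D ->.
  by rewrite card_D; eexists.
rewrite card_A /= -(natr1 d) expo_momentMX mulrA; congr (_ * _).
by rewrite [_.+2`!]factS natrM invfM mulrAC mulVf ?mul1r // pnatr_eq0.
Qed.

Lemma star_count_tperm r i z s : i != z ->
  star_count r z (tperm i z * s)%g
    = \sum_(A : {set 'I_n} | (z \in A) && perm_on A s)
         ((if i \in A then star_weight r #|A|.-1 (tperm i z * s)%g else 0)
          + if s z == i then star_weight r #|A|.-2 (tperm i z * s)%g else 0).
Proof.
move=> iz; rewrite /star_count (bigID (fun A : {set 'I_n} => i \in A)) /=.
rewrite big_split -!big_mkcondr /=; congr (_ + _).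
  apply: eq_bigl => A; case zA: (z \in A); case iA: (i \in A);
    rewrite ?andbF //=.
  by rewrite perm_on_tperm.
pose weight A := star_weight r #|A|.-1 (tperm i z * s)%g.
transitivity (\sum_(A : {set 'I_n}
    | [&& z \in A, i \notin A & perm_on A (tperm i z * s)%g]) weight A).
  by apply: eq_bigl => A; rewrite -andbA [in RHS](andbC (i \notin A)).
rewrite sum_perm_on_tperm //; apply: eq_big => [A|A]; first by rewrite andbA.
case/and3P=> zA sA /eqP s_z.
have iA : i \in A by rewrite -s_z (perm_closed _ sA).
by rewrite /weight (cardsD1 i A) iA.
Qed.

Lemma star_countS r z s :
  star_count r.+1 z s = \sum_(i | i != z) star_count r z (tperm i z * s)%g.
Proof.
rewrite [RHS](eq_bigr _ (fun i iz => star_count_tperm r s iz)) exchange_big /=.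
apply: eq_bigr => A /andP[zA sA].
rewrite big_split (star_weight_rec r sA zA) /=; congr (_ + _).
  by rewrite -big_mkcondr; apply: eq_bigl => i; rewrite andbC.
rewrite -big_mkcondr /=; case: eqVneq => [s_z|s_z].
  rewrite big1 // => i /andP[/negPf iz /eqP z_i].
  by rewrite -z_i s_z eqxx in iz.
rewrite (big_pred1 (s z)) // => i /=.
by case: (eqVneq (s z) i) => [<-|_]; rewrite ?s_z ?andbF.
Qed.

End StarCount.

Section GroupAlgebraCoef.
Variables (R : comNzRingType) (gT : finGroupType).
Implicit Types (x : group_alg R gT) (g h : gT).

Lemma galg_coef_sum (I : Type) (r : seq I) (P : pred I)
    (F : I -> group_alg R gT) g :
  galg_coef (\sum_(i <- r | P i) F i) g
    = \sum_(i <- r | P i) galg_coef (F i) g.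
Proof. by rewrite /galg_coef sum_ffunE. Qed.

Lemma galg_coefZ (a : R) x g : galg_coef (a *: x) g = a * galg_coef x g.
Proof. by rewrite /galg_coef ffunE. Qed.

Lemma galg_coef_elt g h : galg_coef (galg_elt R h) g = (g == h)%:R.
Proof. by rewrite /galg_coef ffunE. Qed.

Lemma galg_coef_eltM h x g :
  galg_coef (galg_elt R h * x) g = galg_coef x (h^-1 * g)%g.
Proof.
rewrite [LHS]ffunE (bigD1 h) //= galg_coef_elt eqxx mul1r big1 ?addr0 // => k.
by rewrite galg_coef_elt => /negPf->; rewrite mul0r.
Qed.

End GroupAlgebraCoef.

Lemma galg_coef_jmM n (x : 'QS_n.+1) s :
  galg_coef (jucys_murphy n * x) s
    = \sum_(i | i != ord_max) galg_coef x (tperm i ord_max * s)%g.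
Proof.
rewrite mulr_suml galg_coef_sum [RHS]big_mkcond (bigD1_ord ord_max) //= eqxx.
rewrite add0r; apply: eq_bigr => i _.
by rewrite galg_coef_eltM tpermV eq_sym neq_lift.
Qed.

Lemma galg_coef_jmX n r (s : 'S_n.+1) :
  galg_coef (jucys_murphy n ^+ r) s = star_count rat r ord_max s.
Proof.
elim: r s => [|r IHr] s; first by rewrite expr0 star_count0 galg_coef_elt.
by rewrite exprS galg_coef_jmM star_countS; apply: eq_bigr => i _; rewrite IHr.
Qed.

Section CondExp.
Variable n : nat.
Implicit Types (t : 'S_n) (D : {set 'I_n}).

Local Notation lift_max t := (lift_perm ord_max ord_max t).

Lemma lift_perm_restr (s : 'S_n.+1) : s ord_max = ord_max ->
  lift_max (perm_restr s) = s.
Proof.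
move=> s_max; apply/permP => i; case: (unliftP ord_max i) => [j|] ->.
  by rewrite lift_perm_lift perm_restrE.
by rewrite lift_perm_id.
Qed.

Lemma perm_restr_lift t : perm_restr (lift_max t) = t.
Proof.
apply/permP => i; apply: (@lift_inj _ ord_max).
by rewrite perm_restrE ?lift_perm_id // lift_perm_lift.
Qed.

Lemma galg_coef_cond_exp (x : 'QS_n.+1) t :
  galg_coef (cond_exp x) t = galg_coef x (lift_max t).
Proof.
rewrite galg_coef_sum (bigD1 (lift_max t)) ?lift_perm_id //=.
rewrite galg_coefZ galg_coef_elt perm_restr_lift eqxx mulr1 big1 ?addr0 //.
move=> s /andP[/eqP s_max s_neq]; rewrite galg_coefZ galg_coef_elt.
case: (t =P perm_restr s) s_neq => [->|_ _]; last by rewrite mulr0.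
by rewrite lift_perm_restr ?eqxx.
Qed.

Lemma perm_char_poly_lift (R : comNzRingType) t :
  perm_char_poly R (lift_max t) = ('X - 1) * perm_char_poly R t.
Proof.
rewrite /perm_char_poly /char_poly (expand_det_row _ ord_max).
rewrite (bigD1 ord_max) //= big1 => [|j j_max].
  rewrite addr0 !mxE lift_perm_id !eqxx mulr1n polyC1; congr (_ * _).
  rewrite /cofactor -signr_odd addnn odd_double mul1r; congr (\det _).
  by apply/matrixP => i j; rewrite !mxE lift_perm_lift !(inj_eq lift_inj).
by rewrite !mxE lift_perm_id eq_sym (negPf j_max) subrr mul0r.
Qed.

Lemma star_poly_lift (R : numFieldType) d t : (d <= n)%N ->
  star_poly R d (lift_max t) = star_poly R d t.
Proof.
move=> d_n; rewrite /star_poly perm_char_poly_lift subSn // exprS.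
by rewrite divp_pmul2l ?expf_neq0 ?polyX1_neq0.
Qed.

Local Notation lift_set D := (ord_max |: (lift ord_max @: D)).

Lemma lift_mem_lift_set D i : (lift ord_max i \in lift_set D) = (i \in D).
Proof.
rewrite !inE eq_sym (negPf (neq_lift _ _)) mem_imset //; exact: lift_inj.
Qed.

Lemma card_lift_set D : #|lift_set D| = #|D|.+1.
Proof.
rewrite cardsU1 card_imset; last exact: lift_inj.
by case: imsetP => // -[i _ /eqP]; rewrite (negPf (neq_lift _ _)).
Qed.

Lemma perm_on_lift D t : perm_on (lift_set D) (lift_max t) = perm_on D t.
Proof.
apply/subsetP/subsetP => supp i; rewrite inE => t_i.
  rewrite -lift_mem_lift_set; apply: supp.
  by rewrite inE lift_perm_lift (inj_eq lift_inj).
case: (unliftP ord_max i) t_i => [j|] ->; last by rewrite setU11.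
by rewrite lift_perm_lift (inj_eq lift_inj) lift_mem_lift_set => /supp.
Qed.

Lemma galg_coef_jm_moment_supports r t :
  galg_coef (jm_moment n r) t
    = \sum_(D : {set 'I_n} | perm_on D t) star_weight rat r #|D| t.
Proof.
rewrite galg_coef_cond_exp galg_coef_jmX /star_count.
rewrite (reindex_onto (fun D : {set 'I_n} => lift_set D)
           (fun A : {set 'I_n.+1} => lift ord_max @^-1: A)) /= => [|A].
  apply: eq_big => D.
    rewrite setU11 perm_on_lift; case: perm_on => //=; apply/eqP/setP => i.
    by rewrite !inE -in_setU1 lift_mem_lift_set.
  rewrite card_lift_set /star_weight star_poly_lift //.
  by have := max_card [in D]; rewrite card_ord.
case/andP=> maxA _; apply/setP => i; case: (unliftP ord_max i) => [j|] ->.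
  by rewrite lift_mem_lift_set inE.
by rewrite setU11 maxA.
Qed.

End CondExp.

(** * Exponential generating functions *)

Section PowerSeries.
Implicit Types (u v w : pseries) (p q : {poly rat}).

Lemma eq_ps_mul u u' v v' : u =1 u' -> v =1 v' -> ps_mul u v =1 ps_mul u' v'.
Proof. by move=> uu' vv' k; apply: eq_bigr => i _; rewrite uu' vv'. Qed.

Lemma ps_mul_coefM p q u v k :
    (forall i, (i <= k)%N -> p`_i = u i) ->
    (forall i, (i <= k)%N -> q`_i = v i) ->
  ps_mul u v k = (p * q)`_k.
Proof.
move=> p_u q_v; rewrite coefM; apply: eq_bigr => i _.
by rewrite p_u ?q_v ?leq_subr // -ltnS.
Qed.

Definition ps_trunc k u : {poly rat} := \poly_(i < k.+1) u i.

Lemma coef_ps_trunc k u i : (i <= k)%N -> (ps_trunc k u)`_i = u i.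
Proof. by rewrite coef_poly ltnS => ->. Qed.

Lemma coef_ps_truncM k u v i : (i <= k)%N ->
  (ps_trunc k u * ps_trunc k v)`_i = ps_mul u v i.
Proof.
move=> ik; apply/esym/ps_mul_coefM => j /leq_trans/(_ ik); exact: coef_ps_trunc.
Qed.

Lemma ps_mulA u v w : ps_mul u (ps_mul v w) =1 ps_mul (ps_mul u v) w.
Proof.
move=> k; rewrite (ps_mul_coefM (@coef_ps_trunc k u) (@coef_ps_truncM k v w)).
by rewrite mulrA (ps_mul_coefM (@coef_ps_truncM k u v) (@coef_ps_trunc k w)).
Qed.

Lemma ps_mul1 u : ps_mul ps_one u =1 u.
Proof.
move=> k; rewrite /ps_mul big_ord_recl big1 => [|i _]; last by rewrite mul0r.
by rewrite mul1r addr0 subn0.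
Qed.

(* [a t^m u(t)] *)
Definition ps_monom (a : rat) m u : pseries :=
  fun k => if (m <= k)%N then a * u (k - m)%N else 0.

Lemma ps_monomE a m u k : ps_monom a m u k = a * ps_coef (k%:Z - m%:Z) u.
Proof.
rewrite /ps_monom; case: leqP => [mk|km]; first by rewrite subzn.
suff -> : k%:Z - m%:Z = Negz (m - k).-1 by rewrite mulr0.
by rewrite NegzE; lia.
Qed.

Lemma eq_ps_monom a m u v : u =1 v -> ps_monom a m u =1 ps_monom a m v.
Proof. by move=> uv k; rewrite /ps_monom uv. Qed.

Lemma coef_ps_trunc_monom k a m u i : (i <= k)%N ->
  (a *: ('X^m * ps_trunc k u))`_i = ps_monom a m u i.
Proof.
move=> ik; rewrite coefZ coefXnM /ps_monom; case: ltnP => _; first exact: mulr0.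
by rewrite coef_ps_trunc // (leq_trans (leq_subr _ _)).
Qed.

Lemma ps_mul_monom a b m l u v :
  ps_mul (ps_monom a m u) (ps_monom b l v)
    =1 ps_monom (a * b) (m + l) (ps_mul u v).
Proof.
move=> k; rewrite (ps_mul_coefM (@coef_ps_trunc_monom k a m u)
                                (@coef_ps_trunc_monom k b l v)).
rewrite -scalerAl -scalerAr scalerA mulrACA -exprD coefZ coefXnM /ps_monom.
by case: ltnP => _; rewrite ?mulr0 // coef_ps_truncM ?leq_subr.
Qed.

Definition ps_expo (c : rat) : pseries := fun k => c ^+ k / k`!%:R.

(* [m t f(m t) = 2 sinh (m t / 2)] *)
Lemma ps_monom_f m k :
  ps_monom m%:R 1 (ps_dilate m%:R ps_f) k
    = ps_expo (m%:R / 2) k - ps_expo (- (m%:R / 2)) k.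
Proof.
case: k => [|k]; first by rewrite /ps_expo !expr0 subrr.
rewrite /ps_monom subn1 /= /ps_dilate /ps_f /ps_dilate /ps_sinh /ps_expo.
rewrite [(- (m%:R / 2)) ^+ _]exprNn !expr_div_n expr1n [m%:R ^+ k.+1]exprS.
have two_neq0 : (2 : rat) ^+ k.+1 != 0 by rewrite expf_neq0.
have fact_neq0 : (k.+1`!%:R : rat) != 0 by rewrite pnatr_eq0 -lt0n fact_gt0.
by field; rewrite fact_neq0 two_neq0.
Qed.

Definition expo_egf (c : rat) (p : {poly rat}) : pseries :=
  fun k => expo_moment c k p / k`!%:R.

Lemma expo_egfB c e p :
  expo_egf (c - e) p =1 ps_mul (ps_expo e) (expo_egf c p).
Proof.
move=> k; rewrite /expo_egf /ps_mul expo_momentE mulr_suml.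
under [RHS]eq_bigr do rewrite expo_momentE mulr_suml mulr_sumr.
rewrite exchange_big; apply: eq_bigr => i _ /=.
rewrite opprB addrCA addrC exprDn !mulr_suml; apply: eq_bigr => j _ /=.
have jk : (j <= k)%N by rewrite -ltnS.
have fact_neq0 m : (m`!%:R : rat) != 0 by rewrite pnatr_eq0 -lt0n fact_gt0.
rewrite /ps_expo -(bin_fact jk) -mulr_natr !natrM; field.
by rewrite !fact_neq0 pnatr_eq0 -lt0n bin_gt0 jk.
Qed.

Lemma expo_egfMXn1 c m p :
  expo_egf (c + m%:R / 2) (('X^m - 1) * p)
    =1 ps_mul (ps_monom m%:R 1 (ps_dilate m%:R ps_f)) (expo_egf c p).
Proof.
move=> k; transitivity (expo_egf (c - m%:R / 2) p k
                        - expo_egf (c - - (m%:R / 2)) p k).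
  rewrite /expo_egf mulrBl mul1r linearB /= mulrBl opprK.
  have -> : c + m%:R / 2 = c - m%:R / 2 + m%:R by field.
  by rewrite expo_momentMXn.
rewrite !expo_egfB -sumrB; apply: eq_bigr => j _.
by rewrite ps_monom_f -mulrBl.
Qed.

Lemma expo_egf1 : expo_egf 0 1 =1 ps_one.
Proof.
move=> k; rewrite /expo_egf expo_momentE size_poly1 big_ord1 coef1 subr0 mulr1.
by rewrite expr0n; case: k => [|k]; rewrite ?fact0 ?divr1 // mul0r.
Qed.

Lemma expo_egf_prod (l : seq nat) :
  expo_egf ((sumn l)%:R / 2) (\prod_(p <- l) ('X^p - 1))
    =1 ps_monom (\prod_(p <- l) p%:R) (size l)
         (\big[ps_mul/ps_one]_(p <- l) ps_dilate p%:R ps_f).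
Proof.
elim: l => [|p l IHl] k.
  by rewrite !big_nil mul0r expo_egf1 /ps_monom mul1r subn0.
rewrite !big_cons /= natrD mulrDl addrC expo_egfMXn1.
by rewrite (eq_ps_mul (frefl _) IHl) ps_mul_monom.
Qed.

Lemma ps_big_nseq_cat d (l : seq nat) :
  \big[ps_mul/ps_one]_(p <- nseq d 1%N ++ l) ps_dilate p%:R ps_f
    =1 ps_mul (ps_exp ps_f d)
         (\big[ps_mul/ps_one]_(p <- l) ps_dilate p%:R ps_f).
Proof.
elim: d => [|d IHd] k /=; first by rewrite ps_mul1.
rewrite big_cons /= -ps_mulA; apply: eq_ps_mul IHd _ => j.
by rewrite /ps_dilate expr1n mul1r.
Qed.

End PowerSeries.

Definition partition_coef r (la : seq nat) : rat :=
  r`!%:R / (sumn la).+1`!%:R * (\prod_(p <- la) p%:R)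
    * ps_coef (r%:Z - (sumn la + size la)%:Z)
        (ps_mul (ps_exp ps_f (sumn la))
                (\big[ps_mul/ps_one]_(p <- la) ps_dilate p%:R ps_f)).

Lemma partition_coefE r la :
  partition_coef r la =
    ((sumn la).+1`!%:R)^-1
      * expo_moment (sumn la)%:R r
          (('X - 1) ^+ sumn la * \prod_(p <- la) ('X^p - 1)).
Proof.
have := expo_egf_prod (nseq (sumn la) 1%N ++ la) r.
rewrite !big_cat /= !big_nseq sumn_cat sumn_nseq mul1n size_cat size_nseq.
rewrite !iter_mulr_1 expr1 expr1n mul1r.
have -> : (sumn la + sumn la)%:R / 2 = (sumn la)%:R :> rat.
  by rewrite natrD; field.
rewrite (eq_ps_monom _ _ (ps_big_nseq_cat _ _)) ps_monomE /expo_egf.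
have fact_neq0 : (r`!%:R : rat) != 0 by rewrite pnatr_eq0 -lt0n fact_gt0.
move/(canRL (divfK fact_neq0)) => ->.
by rewrite /partition_coef; ring.
Qed.

(** * Partitions and cycle types *)

Lemma sum_subsets_card (T : finType) (V : nmodType) (B : {set T})
    (F : nat -> V) :
  \sum_(E : {set T} | E \subset B) F #|E|
    = \sum_(k < #|B|.+1) F k *+ 'C(#|B|, k).
Proof.
rewrite (partition_big (fun E : {set T} => inord #|E| : 'I_#|B|.+1) predT) //=.
apply: eq_bigr => k _; rewrite -cards_draws -sumr_const.
apply: eq_big => [E|E /andP[EB /eqP <-]].
  rewrite inE; case: (boolP (E \subset B)) => //= EB.
  by rewrite -val_eqE /= inordK // ltnS subset_leq_card.
by rewrite inordK // ltnS subset_leq_card.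
Qed.

Lemma sum_supersets_card (T : finType) (V : nmodType) (S : {set T})
    (F : nat -> V) :
  \sum_(D : {set T} | S \subset D) F #|D|
    = \sum_(k < #|~: S|.+1) F (#|S| + k)%N *+ 'C(#|~: S|, k).
Proof.
rewrite -(sum_subsets_card _ (fun k => F (#|S| + k)%N)).
rewrite (reindex_onto (fun E => S :|: E) (fun D => D :\: S)) /= => [|D SD].
  have compl E : (S :|: E) :\: S = E :\: S by rewrite setDUl setDv set0U.
  apply: eq_big => [E|E /andP[_ /eqP SE]].
    by rewrite subsetUl /= compl (sameP eqP setDidPl) disjoints_subset.
  rewrite cardsU disjoint_setI0 ?cards0 ?subn0 // disjoint_sym.
  by apply/setDidPl; rewrite -compl.
by rewrite setDE setUIr setUCr setIT (setUidPr SD).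
Qed.

Section Partitions.
Implicit Types la mu : seq nat.

Definition remove_ones mu := [seq p <- mu | p != 1%N].

Let geq_trans : transitive geq.
Proof. by move=> b a c /= ab bc; apply: leq_trans bc ab. Qed.

Lemma is_partition_subseq la mu :
  subseq la mu -> is_partition mu -> is_partition la.
Proof.
move=> la_mu /andP[mu_sorted mu_gt0].
rewrite /is_partition (subseq_sorted geq_trans la_mu) //=.
by apply: contra mu_gt0; apply: mem_subseq.
Qed.

Lemma partition_ones_last mu : is_partition mu ->
  mu = remove_ones mu ++ nseq (count_mem 1%N mu) 1%N.
Proof.
elim: mu => [//|p mu IHmu] mu_part.
have {}IHmu := IHmu (is_partition_subseq (subseq_cons mu p) mu_part).
have [p1|p_neq1] := eqVneq p 1%N; last first.
  by rewrite /= p_neq1 (negPf p_neq1) /= -IHmu.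
have /all_pred1P -> : all (pred1 1%N) mu.
  apply/allP => q q_mu; case/andP: mu_part => /= mu_sorted.
  rewrite inE negb_or => /andP[_ mu_gt0].
  have := allP (order_path_min geq_trans mu_sorted) q q_mu.
  by case: q q_mu mu_gt0 => [->|[|q]]; rewrite /= ?p1.
by rewrite p1 /remove_ones /= filter_nseq count_nseq mul1n.
Qed.

Lemma sumn_remove_ones mu : is_partition mu ->
  (sumn (remove_ones mu) + count_mem 1%N mu)%N = sumn mu.
Proof.
by move/partition_ones_last=> {3}->; rewrite sumn_cat sumn_nseq mul1n.
Qed.

Lemma count1_remove_ones_cat mu k :
  count_mem 1%N (remove_ones mu ++ nseq k 1%N) = k.
Proof.
rewrite count_cat count_nseq mul1n (_ : count _ _ = 0%N) //.
by apply/count_memPn; rewrite mem_filter eqxx.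
Qed.

Lemma sum_partitions_nseq (V : nmodType) n mu (F : seq nat -> V) :
    is_partition mu -> sumn mu = n ->
  \sum_(la <- partitions_leq n | mu == la ++ nseq (n - sumn la) 1%N) F la
    = \sum_(k < (count_mem 1%N mu).+1) F (remove_ones mu ++ nseq k 1%N).
Proof.
move=> mu_part mu_n; set m := count_mem 1%N mu.
have mu_split := partition_ones_last mu_part.
have sum_mu : (sumn (remove_ones mu) + m)%N = n by rewrite sumn_remove_ones.
pose add_ones k := remove_ones mu ++ nseq k 1%N.
rewrite -big_filter -(big_mkord predT (fun k => F (add_ones k))).
rewrite -(big_map add_ones predT F).
apply: perm_big; apply: uniq_perm.
- by rewrite filter_uniq ?partitions_leq_uniq.
- rewrite map_inj_uniq ?iota_uniq // => k l /(congr1 size)/eqP.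
  by rewrite !size_cat !size_nseq eqn_add2l => /eqP.
move=> la; rewrite mem_filter mem_partitions_leq.
apply/and3P/mapP => [[/eqP mu_la la_part la_n]|[k + ->]].
  exists (count_mem 1%N la).
    rewrite mem_index_iota /= ltnS /m mu_la count_cat; exact: leq_addr.
  rewrite [LHS](partition_ones_last la_part); congr (_ ++ _).
  by rewrite mu_la /remove_ones filter_cat filter_nseq cats0.
rewrite mem_index_iota ltnS => /= k_m.
rewrite sumn_cat sumn_nseq mul1n; split; last by rewrite -sum_mu leq_add2l.
  by rewrite -sum_mu subnDl -catA -nseqD subnKC // -mu_split.
apply: is_partition_subseq mu_part; rewrite [X in subseq _ X]mu_split.
by rewrite -/m -(subnKC k_m) nseqD catA prefix_subseq.
Qed.

End Partitions.

Section CycleType.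
Variable n : nat.
Implicit Types (t : 'S_n) (D : {set 'I_n}).

Local Notation ones t := (count_mem 1%N (cycle_type t)).

Lemma big_cycle_type (S : Type) (idx : S) (op : Monoid.com_law idx)
    (F : nat -> S) t :
  \big[op/idx]_(p <- cycle_type t) F p
    = \big[op/idx]_(C in porbits t) F #|C|.
Proof.
by rewrite /cycle_type (perm_big _ (permEl (perm_sort _ _))) big_image.
Qed.

Lemma cycle_type_partition t : is_partition (cycle_type t).
Proof.
rewrite /is_partition /cycle_type sort_sorted => [|a b]; last exact: leq_total.
rewrite mem_sort; apply/imageP => -[_ /imsetP[x _ ->] /esym/eqP].
by rewrite (negPf (card_porbit_neq0 _ _)).
Qed.

Lemma sumn_cycle_type t : sumn (cycle_type t) = n.
Proof.
rewrite sumnE big_cycle_type -[RHS]card_ord -sum1_card.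
rewrite (partition_big_imset (porbit t)) /=.
apply: eq_bigr => _ /imsetP[x _ ->].
by rewrite -sum1_card; apply: eq_bigl => i; rewrite eq_porbit_mem.
Qed.

Lemma count1_cycle_type t :
  ones t = #|[set i | t i == i]|.
Proof.
rewrite -sum1_count big_mkcond big_cycle_type -big_mkcondr /=.
rewrite sum1_card -[RHS](card_imset _ (@set1_inj _)); apply: eq_card => C.
rewrite unfold_in; apply/andP/imsetP => [[/imsetP[x _ ->]]|[x]].
  case/cards1P=> y orb_x; have := porbit_id t x.
  rewrite orb_x => /set1P xy; exists x; rewrite ?inE -?xy //.
  by have := porbit_stable t x x; rewrite orb_x -xy !inE eqxx.
rewrite inE => /eqP t_x ->; rewrite cards1 -(porbit_fixed t_x).
by rewrite imset_f.
Qed.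

Lemma perm_char_poly_cycle_type (R : numDomainType) t :
  perm_char_poly R t = \prod_(p <- cycle_type t) ('X^p - 1).
Proof. by rewrite perm_char_poly_prod big_cycle_type. Qed.

Lemma star_weight_cycle_type r la t :
    (sumn la <= n)%N -> cycle_type t = la ++ nseq (n - sumn la) 1%N ->
  star_weight rat r (sumn la) t = partition_coef r la.
Proof.
move=> la_n type_t; rewrite partition_coefE /star_weight /star_poly.
rewrite perm_char_poly_cycle_type type_t big_cat big_nseq iter_mulr_1 /= expr1.
by rewrite mulpK ?expf_neq0 ?polyX1_neq0.
Qed.

Lemma galg_coef_a_elt la t :
  galg_coef (a_elt la n) t =
    'C(n - sumn la + count_mem 1%N la, count_mem 1%N la)%:R
      * (cycle_type t == la ++ nseq (n - sumn la) 1%N)%:R.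
Proof.
rewrite galg_coefZ galg_coef_sum; congr (_ * _).
rewrite big_mkcond (bigD1 t) //= galg_coef_elt eqxx big1 ?addr0 => [|s s_t].
  by case: ifP.
by rewrite galg_coef_elt [t == s]eq_sym (negPf s_t) if_same.
Qed.

Lemma sum_perm_on_card (V : nmodType) (F : nat -> V) t :
  \sum_(D : {set 'I_n} | perm_on D t) F #|D|
    = \sum_(k < (ones t).+1) F (n - ones t + k)%N *+ 'C(ones t, k).
Proof.
rewrite count1_cycle_type; set fixed := [set i | t i == i].
transitivity (\sum_(D : {set 'I_n} | ~: fixed \subset D) F #|D|).
  by apply: eq_bigl => D; apply: eq_subset => i; rewrite !inE.
have card_supp : #|~: fixed| = (n - #|fixed|)%N.
  by have := cardsC fixed; rewrite card_ord; lia.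
by rewrite sum_supersets_card setCK card_supp.
Qed.

Lemma galg_coef_jm_moment r t :
  galg_coef (jm_moment n r) t
    = \sum_(k < (ones t).+1)
        partition_coef r (remove_ones (cycle_type t) ++ nseq k 1%N)
          *+ 'C(ones t, k).
Proof.
rewrite galg_coef_jm_moment_supports; set m := ones t.
rewrite (sum_perm_on_card (fun d => star_weight rat r d t)).
apply: eq_bigr => k _; congr (_ *+ _); set rho := remove_ones _.
have type_t : cycle_type t = rho ++ nseq m 1%N.
  exact: partition_ones_last (cycle_type_partition t).
have rho_n : (sumn rho + m)%N = n.
  by rewrite sumn_remove_ones ?sumn_cycle_type ?cycle_type_partition.
have k_m : (k <= m)%N by rewrite -ltnS.
have sum_rho_k : sumn (rho ++ nseq k 1%N) = (n - m + k)%N.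
  by rewrite sumn_cat sumn_nseq; lia.
rewrite -sum_rho_k star_weight_cycle_type //; first by rewrite sum_rho_k; lia.
by rewrite sum_rho_k [LHS]type_t -catA -nseqD; congr (_ ++ nseq _ _); lia.
Qed.

Lemma galg_coef_sum_a_elt (F : seq nat -> rat) t :
  galg_coef (\sum_(la <- partitions_leq n) F la *: a_elt la n) t
    = \sum_(k < (ones t).+1)
        F (remove_ones (cycle_type t) ++ nseq k 1%N) *+ 'C(ones t, k).
Proof.
rewrite galg_coef_sum; set m := ones t.
pose choices la := 'C(n - sumn la + count_mem 1%N la, count_mem 1%N la).
transitivity (\sum_(la <- partitions_leq n
    | cycle_type t == la ++ nseq (n - sumn la) 1%N) F la *+ choices la).
  rewrite [RHS]big_mkcond /=; apply: eq_bigr => la _.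
  rewrite galg_coefZ galg_coef_a_elt.
  by case: eqP => _; rewrite ?mulr1 ?mulr_natr ?mulr0.
rewrite (sum_partitions_nseq _ (cycle_type_partition t) (sumn_cycle_type t)).
apply: eq_bigr => k _; congr (_ *+ _); rewrite /choices count1_remove_ones_cat.
rewrite sumn_cat sumn_nseq mul1n; congr 'C(_, _).
have := sumn_remove_ones (cycle_type_partition t); rewrite sumn_cycle_type.
have := ltn_ord k; rewrite -/m; lia.
Qed.

End CycleType.

Theorem theorem3 (n r : nat) (hn : (1 <= n)%N) :
  jm_moment n r =
    \sum_(la <- partitions_leq n)
      (r`!%:R / (sumn la).+1`!%:R * (\prod_(p <- la) p%:R)
        * ps_coef (r%:Z - (sumn la + size la)%:Z)
            (ps_mul (ps_exp ps_f (sumn la))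
                    (\big[ps_mul/ps_one]_(p <- la) ps_dilate p%:R ps_f)))
      *: a_elt la n.
Proof.
apply/ffunP => t; rewrite -[LHS]/(galg_coef _ t) -[RHS]/(galg_coef _ t).
by rewrite galg_coef_jm_moment (galg_coef_sum_a_elt (partition_coef r)).
Qed.
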